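(* Let $n\ge 1$, let $\theta\in C_n$ be a cyclic permutation of $\{1,\dots,n\}$, and let $\eta=\theta^*\circ\rho_{i_1}\circ\rho_{i_2}\circ\cdots\circ\rho_{i_m}\in S_{2n}$ with $1\le i_1<i_2<\cdots<i_m\le n$. Let $P_\theta(\lambda)$, $P_\eta(\lambda)$, $P_{\mathcal W_1}(\lambda)$, $P_{\mathcal W_2}(\lambda)$ denote the characteristic polynomials of the adjacency matrices of $G(\theta)$, $G(\eta)$, $G(\eta)|_{\mathcal W_1}$ and $G(\eta)|_{\mathcal W_2}$, respectively. Then $P_\eta(\lambda)$ is the product of $P_{\mathcal W_1}(\lambda)$ and $P_{\mathcal W_2}(\lambda)$, namely $$P_\eta(\lambda)=P_{\mathcal W_1}(\lambda)\cdot P_{\mathcal W_2}(\lambda)=P_\theta(\lambda)\cdot(\lambda^n-1).$$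
   Context: $S_n$ is the group of permutations of $\{1,\dots,n\}$, and $C_n\subset S_n$ is the set of cyclic permutations of length $n$, i.e. bijections $\theta$ of $\{1,\dots,n\}$ with $\theta^k(1)\ne 1$ for $1\le k<n$. For $\theta\in C_n$, the permutation $\theta^*\in S_{2n}$ is defined by $\theta^*(2k)=2\theta(k)$ and $\theta^*(2k-1)=2\theta(k)-1$ for $k\in\{1,\dots,n\}$. For $s\in\{1,\dots,n\}$, $\rho_s$ is the transposition exchanging $2s-1$ and $2s$. Composition is of functions, right factor applied first. The number $m$ of transpositions may be odd or even ($m=0$, giving $\eta=\theta^*$, is allowed). For a permutation $\tau\in S_N$, $L_\tau:[1,N]\to[1,N]$ is the continuous map that agrees with $\tau$ on $\{1,\dots,N\}$ and is linear (affine) on each interval $I_i=[i,i+1]$, $1\le i\le N-1$. The digraph $G(\tau)$ has $N-1$ vertices indexed by $1,\dots,N-1$, with a directed edge from vertex $i$ to vertex $j$ (loops allowed) exactly when $I_j\subset L_\tau(I_i)$. (Vertex $i$ is also given the sign $+$ if $\tau(i)<\tau(i+1)$ and $-$ otherwise; signs do not affect adjacency matrices.) The adjacency matrix of $G(\tau)$ is the $(N-1)\times(N-1)$ matrix whose $(i,j)$ entry is $1$ if $I_j\subset L_\tau(I_i)$ and $0$ otherwise. The characteristic polynomial of a square matrix $M$ is $\det(\lambda I-M)$; for the empty matrix (the case $\theta=(1)$) it is $1$. Denote the vertices of $G(\eta)$ by $w_1,\dots,w_{2n-1}$. Put $\mathcal W_1=\{w_2,w_4,\dots,w_{2n-2}\}$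 and $\mathcal W_2=\{w_1,w_3,\dots,w_{2n-1}\}$; $G(\eta)|_{\mathcal W_i}$ is the subgraph of $G(\eta)$ induced on $\mathcal W_i$ (all edges of $G(\eta)$ between vertices of $\mathcal W_i$). *)

(* Defs.v *)
From mathcomp Require Import all_boot all_order all_algebra all_fingroup.
From mathcomp Require Import all_classical all_reals all_analysis.
From mathcomp Require Import zify lra.

Set Implicit Arguments.
Unset Strict Implicit.
Unset Printing Implicit Defensive.

Import Order.TTheory GRing.Theory Num.Theory numFieldNormedType.Exports.

Local Open Scope ring_scope.

(* Throughout, i : 'I_N stands for the integer i + 1 of {1, ..., N}, and
   i : 'I_N.-1 for the vertex i + 1 of G(tau). *)

Definition cyclic_perm (n : nat) (theta : 'S_n) : Prop :=
  forall (i : 'I_n) (k : nat), i = 0%N :> nat -> (1 <= k < n)%N ->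
    (theta ^+ k)%g i <> i.

Lemma ord_odd_proof (n : nat) (k : 'I_n) : (2 * k < 2 * n)%N.
Proof. by rewrite ltn_pmul2l. Qed.

Lemma ord_even_proof (n : nat) (k : 'I_n) : (2 * k + 1 < 2 * n)%N.
Proof. by have := ltn_ord k; lia. Qed.

(* If k stands for s, these stand for 2s - 1 and 2s. *)
Definition ord_odd (n : nat) (k : 'I_n) : 'I_(2 * n) := Ordinal (ord_odd_proof k).
Definition ord_even (n : nat) (k : 'I_n) : 'I_(2 * n) := Ordinal (ord_even_proof k).

Lemma ord_half_proof (n : nat) (j : 'I_(2 * n)) : (j./2 < n)%N.
Proof. by have := ltn_ord j; lia. Qed.

Definition ord_half (n : nat) (j : 'I_(2 * n)) : 'I_n := Ordinal (ord_half_proof j).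

Definition star_fun (n : nat) (theta : 'S_n) (j : 'I_(2 * n)) : 'I_(2 * n) :=
  if odd j then ord_even (theta (ord_half j)) else ord_odd (theta (ord_half j)).

Lemma star_fun_inj (n : nat) (theta : 'S_n) : injective (star_fun theta).
Proof.
move=> j k; rewrite /star_fun.
case: ifP => oj; case: ifP => ok /(congr1 val) /= e; try by exfalso; lia.
- have /perm_inj /(congr1 val) /= : theta (ord_half j) = theta (ord_half k).
    by apply: val_inj => /=; lia.
  by move=> h; apply: val_inj => /=; lia.
- have /perm_inj /(congr1 val) /= : theta (ord_half j) = theta (ord_half k).
    by apply: val_inj => /=; lia.
  by move=> h; apply: val_inj => /=; lia.
Qed.

Definition star (n : nat) (theta : 'S_n) : 'S_(2 * n) :=
  perm (@star_fun_inj n theta).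

Lemma star_odd (n : nat) (theta : 'S_n) (k : 'I_n) :
  star theta (ord_odd k) = ord_odd (theta k).
Proof.
rewrite permE /star_fun ifF /=; last by lia.
by congr (ord_odd (theta _)); apply: val_inj => /=; lia.
Qed.

Lemma star_even (n : nat) (theta : 'S_n) (k : 'I_n) :
  star theta (ord_even k) = ord_even (theta k).
Proof.
rewrite permE /star_fun ifT /=; last by lia.
by congr (ord_even (theta _)); apply: val_inj => /=; lia.
Qed.

Definition rho (n : nat) (k : 'I_n) : 'S_(2 * n) := tperm (ord_odd k) (ord_even k).

(* star theta o rho_(i_1) o ... o rho_(i_m) for s = [:: i_1; ...; i_m];
   the product of permutations applies its left factor first. *)
Definition doubling (n : nat) (theta : 'S_n) (s : seq 'I_n) : 'S_(2 * n) :=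
  foldl (fun p k => (rho k * p)%g) (star theta) s.

(* The map L_tau, as a sum of tent functions centred at 1, ..., N; only its
   values on [1, N] matter. It is characterized by the three lemmas below. *)
Definition linext (R : realType) (N : nat) (tau : 'S_N) (x : R) : R :=
  \sum_(i < N) (tau i).+1%:R * Num.max 0 (1 - `|x - i.+1%:R|).

Lemma linext_continuous (R : realType) (N : nat) (tau : 'S_N) :
  continuous (linext tau : R -> R).
Proof.
rewrite /linext => x; apply: cvg_big => [|i _]; first exact: add_continuous.
apply: cvgM; first exact: cvg_cst.
apply: (@continuous_max R R (fun=> 0) (fun y : R => 1 - `|y - i.+1%:R|) x).
  exact: cvg_cst.
apply: cvgB; first exact: cvg_cst.
by apply: cvg_norm; apply: cvgB; [exact: cvg_id | exact: cvg_cst].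
Qed.

Lemma linext_perm (R : realType) (N : nat) (tau : 'S_N) (i : 'I_N) :
  linext tau (i.+1%:R : R) = (tau i).+1%:R.
Proof.
rewrite /linext (bigD1 i) //= big1 => [|j ji].
  by rewrite subrr normr0 subr0 max_r ?ler01 // mulr1 addr0.
rewrite max_l ?mulr0 // subr_le0.
have nji : (j : nat) <> i by move/val_inj => e; rewrite e eqxx in ji.
have /orP[h|h] : (i.+2 <= j.+1)%N || (j.+2 <= i.+1)%N by lia.
  have : (i.+1%:R + 1 : R) <= j.+1%:R by rewrite natr1 ler_nat.
  by move=> h'; rewrite ler0_norm; lra.
have : (j.+1%:R + 1 : R) <= i.+1%:R by rewrite natr1 ler_nat.
by move=> h'; rewrite ger0_norm; lra.
Qed.

Lemma linext_affine (R : realType) (N : nat) (tau : 'S_N) (i j : 'I_N) (t : R) :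
  j = i.+1 :> nat -> 0 <= t <= 1 ->
  linext tau (i.+1%:R + t) = (1 - t) * (tau i).+1%:R + t * (tau j).+1%:R.
Proof.
move=> ji /andP[t0 t1]; have jNi : j != i by apply/eqP => e; move: ji; rewrite e; lia.
rewrite /linext (bigD1 i) //= (bigD1 j) //= big1 => [|k /andP[ki kj]].
  rewrite addr0 [_ + t]addrC addrK (ger0_norm t0) max_r ?subr_ge0 //.
  have -> : t + i.+1%:R - j.+1%:R = t - 1 :> R.
    by rewrite ji -[i.+2%:R]natr1; lra.
  rewrite ler0_norm ?max_r; [|lra..].
  by rewrite mulrC [_ * (1 - - _)]mulrC; congr (_ + _ * _); lra.
rewrite max_l ?mulr0 // subr_le0.
have nki : (k : nat) <> i by move/val_inj => e; rewrite e eqxx in ki.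
have nkj : (k : nat) <> j by move/val_inj => e; rewrite e eqxx in kj.
have /orP[h|h] : (k.+1 <= i)%N || (i.+2 <= k)%N by lia.
  have : (k.+1%:R + 1 : R) <= i.+1%:R by rewrite natr1 ler_nat.
  by move=> h'; rewrite ger0_norm; lra.
have : (i.+1%:R + 1 + 1 : R) <= k.+1%:R by rewrite !natr1 ler_nat.
by move=> h'; rewrite ler0_norm; lra.
Qed.

Definition unit_itv (R : realType) (i : nat) : set R :=
  `[i.+1%:R, i.+2%:R]%classic.
Arguments unit_itv : clear implicits.

Definition edge (R : realType) (N : nat) (tau : 'S_N) : rel 'I_N.-1 :=
  fun i j => `[< (unit_itv R j `<=` @linext R N tau @` unit_itv R i)%classic >].
Arguments edge : clear implicits.
Arguments edge R {N} tau.

Definition induced (N : nat) (e : rel 'I_N) (W : {set 'I_N}) : rel 'I_#|W| :=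
  fun i j => e (enum_val i) (enum_val j).
Arguments induced {N} e W.

Definition adjacency (N : nat) (e : rel 'I_N) : 'M[int]_N :=
  \matrix_(i, j) (e i j)%:R.

(* The vertex j : 'I_(2 * n).-1 is w_(j + 1). *)
Definition W1 (n : nat) : {set 'I_(2 * n).-1} :=
  [set j : 'I_(2 * n).-1 | ~~ odd j.+1]%SET.
Definition W2 (n : nat) : {set 'I_(2 * n).-1} :=
  [set j : 'I_(2 * n).-1 | odd j.+1]%SET.

(* Main.v *)
(** The permutation eta maps the pair {2k-1, 2k} onto {2 theta(k) - 1,
    2 theta(k)}. Hence the interval between the points of one pair is mapped
    onto the interval of another pair: no edge leaves W_2, the adjacency matrix
    is block triangular, and the block of W_2 is the permutation matrix of
    theta, an n-cycle. The interval between the pairs k and k+1 covers the one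
    between the pairs l and l+1 exactly when theta(k) and theta(k+1) lie on
    different sides of it, so the block of W_1 is the matrix of G(theta). *)

Require Import Defs.
From mathcomp Require Import all_boot all_order all_algebra all_fingroup.
From mathcomp Require Import all_classical all_reals.
From mathcomp Require Import zify ring lra.

Import Order.TTheory GRing.Theory Num.Theory.

Local Open Scope ring_scope.

(** * Characteristic polynomials of reindexed, block triangular and cyclic matrices *)

(** The same permutation [s] acts on rows and columns, so its sign enters the determinant twice and
    cancels. The sizes [p] and [q] are separate because sizes such as [#|W|] equal the intended ones
    only propositionally. *)
Lemma char_poly_reindex (K : comNzRingType) (T : finType) (E : T -> T -> K)
    (p q : nat) (f : 'I_p -> T) (g : 'I_q -> T) :
  injective f -> injective g -> codom f =i codom g ->
  char_poly (\matrix_(i, j) E (f i) (f j)) =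
  char_poly (\matrix_(i, j) E (g i) (g j)).
Proof.
move=> fI gI fg.
have epq : p = q.
  by rewrite -[p]card_ord -[q]card_ord -(card_codom fI) -(card_codom gI) (eq_card fg).
subst q.
have h_ex i : f i \in codom g by rewrite -fg codom_f.
pose h i := iinv (h_ex i).
have gh i : g (h i) = f i by exact: f_iinv.
have hI : injective h by move=> i j /(congr1 g); rewrite !gh => /fI.
pose s := perm hI.
have gs i : g (s i) = f i by rewrite permE gh.
rewrite /char_poly; set B := char_poly_mx (\matrix_(i, j) E (g i) (g j)).
have -> : char_poly_mx (\matrix_(i, j) E (f i) (f j)) = row_perm s (col_perm s B).
  by apply/matrixP => i j; rewrite !mxE !gs (inj_eq perm_inj).
rewrite row_permE col_permE !det_mulmx !det_perm odd_permV mulrCA -signr_addb.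
by rewrite addbb expr0 mulr1.
Qed.

Lemma char_poly_lblock (K : comNzRingType) (p q : nat)
    (A : 'M[K]_p) (C : 'M[K]_(q, p)) (B : 'M[K]_q) :
  char_poly (block_mx A 0 C B) = char_poly A * char_poly B.
Proof.
rewrite /char_poly -(det_lblock _ (- map_mx polyC C)); congr (\det _).
rewrite /char_poly_mx map_block_mx map_mx0 scalar_mx_block.
by rewrite opp_block_mx add_block_mx oppr0 addr0 add0r.
Qed.

(** Listing [W] before its complement makes the upper right block the edges that leave [W], hence
    zero. *)
Lemma char_poly_adjacency_closed (N : nat) (e : rel 'I_N) (W : {set 'I_N}) :
  (forall i j, i \in W -> j \notin W -> ~~ e i j) ->
  char_poly (adjacency e) =
  char_poly (adjacency (induced e (~: W))) * char_poly (adjacency (induced e W)).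
Proof.
move=> We.
pose f (i : 'I_(#|W| + #|~: W|)) : 'I_N :=
  match fintype.split i with inl a => enum_val a | inr b => enum_val b end.
have fl a : f (lshift _ a) = enum_val a by rewrite /f (unsplitK (inl a)).
have fr b : f (rshift _ b) = enum_val b by rewrite /f (unsplitK (inr b)).
have WP (a : 'I_#|W|) : enum_val a \in W by exact: enum_valP.
have VP (b : 'I_#|~: W|) : enum_val b \notin W by rewrite -finset.in_setC enum_valP.
have fI : injective f.
  move=> i j; rewrite -[i]splitK -[j]splitK /=.
  case: (fintype.split i) => a; case: (fintype.split j) => b /=; rewrite ?fl ?fr => e1.
  - by rewrite (enum_val_inj e1).
  - by have := VP b; rewrite -e1 WP.
  - by have := VP a; rewrite e1 WP.
  - by rewrite (enum_val_inj e1).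
have fs : codom f =i codom (@id 'I_N).
  move=> j; rewrite (codom_f (@id 'I_N) j); apply: inj_card_onto => //.
  by rewrite !card_ord finset.cardsC card_ord.
have -> : adjacency e = \matrix_(i, j) (e (id i) (id j))%:R by [].
rewrite -(char_poly_reindex _ _ (fun i j => (e i j)%:R) _ _ f id) //.
rewrite mulrC.
rewrite -(char_poly_lblock _ _ _ _ (\matrix_(i, j) (e (enum_val i) (enum_val j))%:R)).
congr char_poly; apply/matrixP => i j.
rewrite mxE -[i]splitK -[j]splitK.
case: (fintype.split i) => a; case: (fintype.split j) => b /=; rewrite ?fl ?fr.
- by rewrite block_mxEul mxE.
- by rewrite block_mxEur mxE (negPf (We _ _ (WP a) (VP b))).
- by rewrite block_mxEdl mxE.
- by rewrite block_mxEdr mxE.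
Qed.

(** Replaces the numbering by [enum_val] built into [induced] with an explicit parametrization [f]
    of [W]. *)
Lemma char_poly_induced (N m : nat) (e : rel 'I_N) (e' : rel 'I_m)
    (W : {set 'I_N}) (f : 'I_m -> 'I_N) :
  injective f -> codom f =i W -> (forall i j, e (f i) (f j) = e' i j) ->
  char_poly (adjacency (induced e W)) = char_poly (adjacency e').
Proof.
move=> fI fW ee'.
have -> : adjacency e' = \matrix_(i, j) (e (f i) (f j))%:R.
  by apply/matrixP => i j; rewrite !mxE ee'.
apply: (char_poly_reindex _ _ (fun i j => (e i j)%:R)) => //.
  exact: enum_val_inj.
move=> x; rewrite fW; apply/codomP/idP => [[i ->]|xW]; first exact: enum_valP.
by exists (enum_rank_in xW x); rewrite enum_rankK_in.
Qed.

(* Along the orbit of 0 the matrix of a cyclic permutation becomes the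
   companion matrix of X^n - 1. *)
Lemma char_poly_cyclic (n : nat) (theta : 'S_n) : (1 <= n)%N ->
  cyclic_perm theta ->
  char_poly (adjacency (fun i j => theta i == j)) = 'X^n - 1.
Proof.
case: n theta => // n theta _ cyc.
have sz : size ('X^(n.+1) - 1 : {poly int}) = n.+2 by rewrite size_XnsubC.
rewrite -[RHS]companionmxK; last exact: monicXnsubC.
have cyc' k : (0 < k < n.+1)%N -> (theta ^+ k)%g ord0 <> ord0 by exact: cyc.
(* The [i]-th point of the orbit of 0, indexed by the row type of [companionmx]. *)
pose f (i : 'I_(size ('X^(n.+1) - 1 : {poly int})).-1) := (theta ^+ i)%g ord0.
have size_pred : (size ('X^(n.+1) - 1 : {poly int})).-1 = n.+1 by rewrite sz.
have lt_n (i : 'I_(size ('X^(n.+1) - 1 : {poly int})).-1) : (i < n.+1)%N.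
  by rewrite -[X in (_ < X)%N]size_pred.
have lt_f (i j : nat) : (i < j < n.+1)%N -> (theta ^+ i)%g ord0 <> (theta ^+ j)%g ord0.
  move=> /andP[ij jn] h; apply: (cyc' (j - i)%N); first by lia.
  apply: (@perm_inj _ (theta ^+ i)%g).
  by rewrite -permM -expgD subnK ?h // ltnW.
have fI : injective f.
  move=> i j fij; apply: val_inj => /=.
  have jn := lt_n j; have i_n := lt_n i.
  case: (ltngtP i j) => // ij; exfalso.
    by apply: (lt_f i j) => //; rewrite ij jn.
  by apply: (lt_f j i) => //; rewrite ij i_n.
have f_onto y : y \in codom f by apply: inj_card_onto => //; rewrite !card_ord sz.
(* The point reached after [n.+1] steps is some [f k]; with [k > 0] the orbit would already return
   to 0 after [n.+1 - k] steps. *)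
have theta_n : (theta ^+ n.+1)%g ord0 = ord0.
  have /codomP[k] := f_onto ((theta ^+ n.+1)%g ord0).
  rewrite /f => h; have kn := lt_n k.
  case: (posnP k) => [k0|k0]; first by rewrite h k0 expg0 perm1.
  exfalso; apply: (cyc' (n.+1 - k)%N); first by lia.
  apply: (@perm_inj _ (theta ^+ k)%g).
  by rewrite -permM -expgD subnK ?h // ltnW.
have -> : adjacency (fun i j => theta i == j) =
    \matrix_(i, j) (theta (id i) == id j)%:R by [].
rewrite -(char_poly_reindex _ _ (fun i j => (theta i == j)%:R) _ _ f id) //; last first.
  by move=> y; rewrite f_onto (codom_f (@id 'I_n.+1) y).
congr char_poly; apply/matrixP => i j; rewrite !mxE.
have jn := lt_n j; have i_n := lt_n i.
have -> : theta (f i) = (theta ^+ i.+1)%g ord0 by rewrite expgSr permM.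
have -> : (size ('X^(n.+1) - 1 : {poly int})).-1.-1 = n by rewrite sz.
(* The last row of [companionmx] holds the negated coefficients, here a single 1 in column 0: the
   orbit closes up. Any other row [i] has its 1 in column [i.+1]: one step along the orbit. *)
case: (eqVneq (i : nat) n) => [->|i_n'].
  rewrite theta_n coefB coefXn coef1 ltn_eqF // sub0r opprK; congr (nat_of_bool _)%:R.
  apply/eqP/eqP => [h|j0]; last by rewrite /f j0 expg0 perm1.
  case: (posnP j) => // j0; exfalso; apply: (cyc' j); first by rewrite j0.
  by rewrite -/(f j) -h.
congr (nat_of_bool _)%:R.
apply/eqP/eqP => [h|-> //].
case: (ltngtP i.+1 j) => // ij; exfalso.
  by apply: (lt_f i.+1 j) => //; rewrite ij jn.
by apply: (lt_f j i.+1) => //; rewrite ij; lia.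
Qed.

(** * Edges as inequalities between integers *)

Lemma convex_comb_bounds (K : realFieldType) (t x y l u : K) :
  0 <= t <= 1 -> l <= x <= u -> l <= y <= u -> l <= (1 - t) * x + t * y <= u.
Proof. by move=> /andP[? ?] /andP[? ?] /andP[? ?]; apply/andP; split; nra. Qed.

Lemma convex_comb_surj (K : realFieldType) (x y z : K) :
  (x <= z <= y) || (y <= z <= x) ->
  exists2 t : K, 0 <= t <= 1 & (1 - t) * x + t * y = z.
Proof.
have [-> /orP zy|xy h] := eqVneq x y.
  exists 0; first by rewrite lexx ler01.
  rewrite subr0 mul1r mul0r addr0; apply/eqP.
  by rewrite eq_le; case: zy => /andP[-> ->].
have yx0 : y - x != 0 by rewrite subr_eq0 eq_sym.
exists ((z - x) / (y - x)); last by field.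
case/orP: h => /andP[h1 h2].
  have d : 0 < y - x by rewrite subr_gt0 lt_neqAle xy (le_trans h1 h2).
  by rewrite divr_ge0 ?ler_pdivrMr //=; lra.
have d : 0 < x - y by rewrite subr_gt0 lt_neqAle eq_sym xy (le_trans h1 h2).
(* Here [y < x]: both signs are flipped to get a positive denominator. *)
by rewrite -[_ / _]mulrNN -invrN !opprB divr_ge0 ?ler_pdivrMr //=; lra.
Qed.

(** The image of an interval under the affine piece is the segment between the images of its ends.
    These are integers, so covering a unit interval is a condition on integers alone. *)
Lemma edgeE (R : realType) (N : nat) (tau : 'S_N) (i j : 'I_N.-1) (a b : 'I_N) :
  a = i :> nat -> b = i.+1 :> nat ->
  edge R tau i j = (minn (tau a) (tau b) <= j < maxn (tau a) (tau b))%N.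
Proof.
move=> ai bi.
have ba : b = a.+1 :> nat by rewrite ai.
have LE (t : R) : 0 <= t <= 1 ->
    linext tau (i.+1%:R + t) = (1 - t) * (tau a).+1%:R + t * (tau b).+1%:R.
  by rewrite -ai; exact: linext_affine.
have image y : (linext tau @` unit_itv R i)%classic y <->
    exists2 t : R, 0 <= t <= 1 & (1 - t) * (tau a).+1%:R + t * (tau b).+1%:R = y.
  rewrite /unit_itv; split => [[x /=]|[t t01 <-]].
    rewrite in_itv /= -[i.+2%:R]natr1 => /andP[x0 x1] <-.
    have t01 : 0 <= x - i.+1%:R <= 1 by apply/andP; split; lra.
    by exists (x - i.+1%:R) => //; rewrite -LE // addrC subrK.
  exists (i.+1%:R + t); last exact: LE.
  rewrite /= in_itv /= -[i.+2%:R]natr1.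
  by move/andP: t01 => [? ?]; apply/andP; split; lra.
apply/asboolP/andP => [sub|[lo hi] y].
  (* For necessity it is enough to test the two ends of the covered interval, [k = j] and
     [k = j.+1]. *)
  have end_in k : (j <= k <= j.+1)%N ->
      (minn (tau a) (tau b) <= k <= maxn (tau a) (tau b))%N.
    move=> /andP[jk kj].
    have /sub /image[t t01 e] : unit_itv R j k.+1%:R.
      by rewrite /unit_itv /= in_itv /= !ler_nat !ltnS jk kj.
    suff : ((minn (tau a) (tau b)).+1%:R : R) <= (k.+1%:R : R) <=
           ((maxn (tau a) (tau b)).+1%:R : R).
      by rewrite !ler_nat !ltnS.
    rewrite -e; apply: convex_comb_bounds => //.
      by rewrite !ler_nat !ltnS geq_minl leq_maxl.
    by rewrite !ler_nat !ltnS geq_minr leq_maxr.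
  have := end_in j; have := end_in j.+1; rewrite !leqnn !leqnSn.
  by move=> /(_ isT)/andP[_ ->] /(_ isT)/andP[-> _].
rewrite /unit_itv /= in_itv /= => /andP[y0 y1]; apply/image.
apply: convex_comb_surj.
have between (p q : nat) : (p <= j)%N -> (j < q)%N -> p.+1%:R <= y <= q.+1%:R.
  move=> pj jq; apply/andP; split.
    by apply: le_trans y0; rewrite ler_nat.
  by apply: le_trans y1 _; rewrite ler_nat.
case: (leqP (tau a) (tau b)) lo hi => [ab|/ltnW ab] lo hi; apply/orP.
  by left; apply: between; lia.
by right; apply: between; lia.
Qed.

(** * Edges of the doubled permutation *)

(** [ord_half] gives the pair of a point. [star theta] moves pairs by [theta], and each [rho k] only
    swaps points within a pair. *)
Lemma ord_half_doubling (n : nat) (theta : 'S_n) (s : seq 'I_n) (j : 'I_(2 * n)) :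
  ord_half (doubling theta s j) = theta (ord_half j).
Proof.
rewrite /doubling.
have : forall j, ord_half (star theta j) = theta (ord_half j).
  move=> k; rewrite permE /star_fun; case: ifP => _; apply: val_inj => /=; lia.
(* The starting permutation is generalized, since [foldl] changes its accumulator. *)
elim: s (star theta) j => [|k s IHs] p j hp /=; first exact: hp.
apply: IHs => {}j; rewrite permM hp; congr (theta _).
by rewrite /rho; case: tpermP => [->|->|//]; apply: val_inj => /=; lia.
Qed.

Lemma half_doubling (n : nat) (theta : 'S_n) (s : seq 'I_n) (j : 'I_(2 * n))
    (k : 'I_n) :
  j./2 = k -> (doubling theta s j)./2 = theta k.
Proof.
move=> jk; rewrite -[LHS]/(val (ord_half (doubling theta s j))) ord_half_doubling.
by congr (val (theta _)); apply: val_inj.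
Qed.

(** The index [2 * k] is the vertex $w_{2k+1}$ of $\mathcal W_2$. The ends of its interval go to the
    two distinct points of one pair, in either order. *)
Lemma edge_doubling_even (R : realType) (n : nat) (theta : 'S_n) (s : seq 'I_n)
    (k : 'I_n) (i j : 'I_(2 * n).-1) :
  i = (2 * k)%N :> nat ->
  edge R (doubling theta s) i j = (j == (2 * theta k)%N :> nat).
Proof.
move=> ik; set eta := doubling theta s.
rewrite (@edgeE R _ eta i j (ord_odd k) (ord_even k)) /=; [|lia..].
have ho : (eta (ord_odd k))./2 = theta k by apply: half_doubling => /=; lia.
have he : (eta (ord_even k))./2 = theta k by apply: half_doubling => /=; lia.
have ne : eta (ord_odd k) <> eta (ord_even k) :> nat.
  by move/val_inj/perm_inj/(congr1 val) => /=; lia.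
lia.
Qed.

(** These indices are vertices of $\mathcal W_1$. A value [x] satisfies [x <= (2 * l).+1] exactly
    when [x./2 <= l], so only the pairs of the images matter, not the order within them. *)
Lemma edge_doubling_odd (R : realType) (n : nat) (theta : 'S_n) (s : seq 'I_n)
    (i j : 'I_(2 * n).-1) (k l : 'I_n.-1) :
  i = (2 * k).+1 :> nat -> j = (2 * l).+1 :> nat ->
  edge R (doubling theta s) i j = edge R theta k l.
Proof.
move=> ik jl; set eta := doubling theta s.
have kn0 : (k < n)%N by have := ltn_ord k; lia.
have kn1 : (k.+1 < n)%N by have := ltn_ord k; lia.
pose a := Ordinal kn0; pose b := Ordinal kn1.
rewrite (@edgeE R _ theta k l a b) //.
rewrite (@edgeE R _ eta i j (ord_even a) (ord_odd b)) /=; [|lia..].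
have he : (eta (ord_even a))./2 = theta a by apply: half_doubling => /=; lia.
have ho : (eta (ord_odd b))./2 = theta b by apply: half_doubling => /=; lia.
lia.
Qed.

Theorem theorem3p1 (R : realType) (n : nat) (theta : 'S_n) (s : seq 'I_n) :
  (1 <= n)%N ->
  cyclic_perm theta ->
  sorted (fun i j : 'I_n => (i < j)%N) s ->
  let eta := doubling theta s in
  let P_theta := char_poly (adjacency (edge R theta)) in
  let P_eta := char_poly (adjacency (edge R eta)) in
  let P_W1 := char_poly (adjacency (induced (edge R eta) (W1 n))) in
  let P_W2 := char_poly (adjacency (induced (edge R eta) (W2 n))) in
  P_eta = P_W1 * P_W2 /\ P_W1 * P_W2 = P_theta * ('X^n - 1).
Proof.
move=> n1 cyc _ /=; set eta := doubling theta s.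
(* Index [j] stands for $w_{j+1}$, which flips the parity. *)
have inW1 (j : 'I_(2 * n).-1) : (j \in W1 n) = odd j by rewrite finset.inE /= negbK.
have inW2 (j : 'I_(2 * n).-1) : (j \in W2 n) = ~~ odd j by rewrite finset.inE.
have half_lt (j : 'I_(2 * n).-1) : (j./2 < n)%N by have := ltn_ord j; lia.
have half_lt1 (j : 'I_(2 * n).-1) : odd j -> (j./2 < n.-1)%N.
  by have := ltn_ord j; lia.
have odd_lt (k : 'I_n.-1) : ((2 * k).+1 < (2 * n).-1)%N by have := ltn_ord k; lia.
have even_lt (k : 'I_n) : (2 * k < (2 * n).-1)%N by have := ltn_ord k; lia.
have W1C : W1 n = finset.setC (W2 n).
  by apply/setP => j; rewrite finset.in_setC inW1 inW2 negbK.
split.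
  rewrite W1C; apply: char_poly_adjacency_closed => i j.
  rewrite !inW2 negbK => ei oj.
  rewrite (@edge_doubling_even R n theta s (Ordinal (half_lt i))) /=; last by lia.
  by apply/eqP => ej; move: oj; rewrite ej; lia.
(* The factors are matched separately: [k] goes to [(2 * k).+1] for $\mathcal W_1$, and below to
   [2 * k] for $\mathcal W_2$. *)
congr (_ * _).
  apply: (@char_poly_induced _ _ _ _ _ (fun k => Ordinal (odd_lt k))).
  - by move=> k l /(congr1 val) /= h; apply: val_inj => /=; lia.
  - move=> j; rewrite inW1; apply/codomP/idP => [[k ->] /=|oj]; first by lia.
    by exists (Ordinal (half_lt1 j oj)); apply: val_inj => /=; lia.
  - by move=> k l; apply: edge_doubling_odd.
rewrite -(@char_poly_cyclic _ theta) //.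
apply: (@char_poly_induced _ _ _ _ _ (fun k => Ordinal (even_lt k))).
- by move=> k l /(congr1 val) /= h; apply: val_inj => /=; lia.
- move=> j; rewrite inW2; apply/codomP/idP => [[k ->] /=|oj]; first by lia.
  by exists (Ordinal (half_lt j)); apply: val_inj => /=; lia.
- move=> k l; rewrite (@edge_doubling_even R n theta s k) //=.
  by apply/eqP/eqP => [h|<- //]; apply: val_inj => /=; lia.
Qed.
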